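(* Let $S\in\mathbb{R}^{\nu\times\nu}$, $L\in\mathbb{R}^{1\times\nu}$ with $(L,S)$ observable and $\sigma(S)\cap\Omega=\emptyset$, and let $\Pi\in\mathbb{R}^{n\times\nu}$ be the unique solution of $M\Pi S^2+D\Pi S+K\Pi=BL$. Let $m<\nu$, let $Q_z\in\mathbb{R}^{m\times m}$ with $\sigma(Q_z)=\{z_1,\dots,z_m\}$ (a set symmetric under complex conjugation), $\sigma(Q_z)\cap\Omega=\emptyset$ and $\sigma(Q_z)\cap\sigma(S)=\emptyset$, and let $R_z\in\mathbb{R}^m$ be such that $(Q_z,R_z)$ is controllable. Let $\Upsilon_z\in\mathbb{R}^{m\times n}$ be the unique solution of $$Q_z^2\Upsilon_zM+Q_z\Upsilon_zD+\Upsilon_zK=R_zC_0+Q_zR_zC_1,$$ and assume $\operatorname{rank}\Upsilon_z=m$, $\operatorname{rank}(\Upsilon_z\Pi)=m$, and that $z_1,\dots,z_m$ are zeros of $W$ (counted with multiplicity), so that $\Upsilon_zB=0$. Consider the family $\widehat\Sigma_G$ of reduced models of order $\nu$, parameterized by $F_1,F_2,G,H_1$, matching the moments of $\Sigma$ at $\sigma(S)$. If $$H_1=C_1\Pi,\qquad \Upsilon_z\Pi F_2=-\Upsilon_zM\Pi,\qquad \Upsilon_z\Pi F_1=-\Upsilon_zD\Pi,\qquad \Upsilon_z\Pi G=0,$$ then $z_1,\dots,z_m$ are zeros of the system $\widehat\Sigma_G$.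
   Context: $\Sigma$ is the single-input single-output second-order system $M\ddot x+D\dot x+Kx=Bu$, $y=C_1\dot x+C_0x$, with $M,D,K\in\mathbb{R}^{n\times n}$, $B\in\mathbb{R}^{n}$, $C_0,C_1\in\mathbb{R}^{1\times n}$, transfer function $W(s)=(C_1s+C_0)(Ms^2+Ds+K)^{-1}B$; $\Omega=\{s\in\mathbb{C}:\det(Ms^2+Ds+K)=0\}$ is assumed to consist of $2n$ points counted with multiplicity; $\nu<n$. The family $\widehat\Sigma_G$ consists of the models $F_2\ddot\xi+F_1\dot\xi+F_0\xi=Gu$, $\psi=H_1\dot\xi+H_0\xi$, with free parameters $F_1,F_2\in\mathbb{R}^{\nu\times\nu}$, $G\in\mathbb{R}^{\nu}$, $H_1\in\mathbb{R}^{1\times\nu}$ and with $F_0=GL-F_2S^2-F_1S$, $H_0=C_0\Pi+C_1\Pi S-H_1S$. It is assumed that $\det(s^2F_2+sF_1+F_0)$ is not identically zero and has $2\nu$ roots counted with multiplicity. A number $z\in\mathbb{C}$ is a zero of $\widehat\Sigma_G$ if $$\det\begin{bmatrix}F_2z^2+F_1z+F_0&-G\\ H_1z+H_0&0\end{bmatrix}=0.$$ *)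

(* Defs.v *)
From HB Require Import structures.
From mathcomp Require Import all_boot all_order all_algebra.
From mathcomp Require Import reals.
From mathcomp Require Import complex.

Set Implicit Arguments.
Unset Strict Implicit.
Unset Printing Implicit Defensive.

Import Order.TTheory GRing.Theory Num.Theory.
Local Open Scope ring_scope.

(* The single-input single-output system
     M x'' + D x' + K x = B u,   y = C1 x' + C0 x. *)
Record so_system (R : nzRingType) (n : nat) := SOSystem {
  so_M : 'M[R]_n;
  so_D : 'M[R]_n;
  so_K : 'M[R]_n;
  so_B : 'cV[R]_n;
  so_C1 : 'rV[R]_n;
  so_C0 : 'rV[R]_n }.

Section SecondOrderSystems.

Variable R : realType.

(* The map [f] pushes the real coefficients into the ring where [s] lives:
   [A] is instantiated below by C, C[s] and C(s). *)
Definition so_pencil (A : nzRingType) (f : R -> A) n (X : so_system R n)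
    (s : A) : 'M[A]_n :=
  s ^+ 2 *: map_mx f (so_M X) + s *: map_mx f (so_D X) + map_mx f (so_K X).

Definition so_output (A : nzRingType) (f : R -> A) n (X : so_system R n)
    (s : A) : 'rV[A]_n :=
  s *: map_mx f (so_C1 X) + map_mx f (so_C0 X).

Definition real_polyC (x : R) : {poly R[i]} := (real_complex R x)%:P.
Definition real_fracC (x : R) : {fraction {poly R[i]}} := tofrac (real_polyC x).

Definition so_charpoly n (X : so_system R n) : {poly R[i]} :=
  \det (so_pencil real_polyC X 'X).

(* This is (C1 s + C0) (M s^2 + D s + K)^-1 B as an element of C(s).  It is
   meaningful when [so_charpoly X != 0]: [invmx] of a singular matrix is that
   matrix itself. *)
Definition so_transfer n (X : so_system R n) : {fraction {poly R[i]}} :=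
  let s := tofrac 'X in
  (so_output real_fracC X s *m invmx (so_pencil real_fracC X s)
     *m map_mx real_fracC (so_B X)) 0 0.

Definition so_Omega n (X : so_system R n) : pred R[i] :=
  fun s => \det (so_pencil (real_complex R) X s) == 0.

(* Rosenbrock system matrix *)
Definition so_zero n (X : so_system R n) (s : R[i]) : Prop :=
  \det (block_mx (so_pencil (real_complex R) X s)
                 (- map_mx (real_complex R) (so_B X))
                 (so_output (real_complex R) X s)
                 (0 : 'M_1)) = 0.

(* [p] is nonzero and has exactly [k] roots counted with multiplicity; [%=] is
   equality up to a nonzero constant. *)
Definition has_roots (p : {poly R[i]}) (k : nat) : Prop :=
  p != 0 /\
  exists rs : seq R[i], size rs = k /\ p %= \prod_(r <- rs) ('X - r%:P).

(* The rational function [f] is regular at [s] and vanishes there with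
   multiplicity at least [k]. *)
Definition vanishes_to_order (f : {fraction {poly R[i]}}) (s : R[i])
    (k : nat) : Prop :=
  exists p q : {poly R[i]},
    [/\ f = tofrac p / tofrac q, q.[s] != 0 & ('X - s%:P) ^+ k %| p].

(* The entries of [zs] are zeros of [f], repeated entries being counted with
   multiplicity. *)
Definition zeros_of (f : {fraction {poly R[i]}}) (zs : seq R[i]) : Prop :=
  forall s, s \in zs -> vanishes_to_order f s (count_mem s zs).

Definition spectrum n (A : 'M[R]_n) : pred R[i] :=
  eigenvalue (map_mx (real_complex R) A).

Definition has_spectrum n (A : 'M[R]_n) (zs : seq R[i]) : Prop :=
  char_poly (map_mx (real_complex R) A) = \prod_(s <- zs) ('X - s%:P).

Definition disjoint_sets (P Q : pred R[i]) : Prop := forall s, ~~ (P s && Q s).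

Definition observability_mx n (L : 'rV[R]_n) (S : 'M[R]_n) : 'M[R]_n :=
  \matrix_(i < n, j < n) (L *m S ^+ i) 0 j.

Definition observable n (L : 'rV[R]_n) (S : 'M[R]_n) : Prop :=
  \rank (observability_mx L S) = n.

Definition controllability_mx n (Q : 'M[R]_n) (B : 'cV[R]_n) : 'M[R]_n :=
  \matrix_(i < n, j < n) (Q ^+ j *m B) i 0.

Definition controllable n (Q : 'M[R]_n) (B : 'cV[R]_n) : Prop :=
  \rank (controllability_mx Q B) = n.

(* The family of order-[nu] models matching the moments of [X] at the spectrum
   of [S], with free parameters [F1 F2 G H1]. *)
Definition family_G n nu (X : so_system R n)
    (S : 'M[R]_nu) (L : 'rV[R]_nu) (Pi : 'M[R]_(n, nu))
    (F1 F2 : 'M[R]_nu) (G : 'cV[R]_nu) (H1 : 'rV[R]_nu) : so_system R nu :=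
  {| so_M := F2;
     so_D := F1;
     so_K := G *m L - F2 *m S ^+ 2 - F1 *m S;
     so_B := G;
     so_C1 := H1;
     so_C0 := so_C0 X *m Pi + so_C1 X *m Pi *m S - H1 *m S |}.

Definition right_sylvester n nu (X : so_system R n)
    (S : 'M[R]_nu) (L : 'rV[R]_nu) (Pi : 'M[R]_(n, nu)) : Prop :=
  so_M X *m Pi *m S ^+ 2 + so_D X *m Pi *m S + so_K X *m Pi = so_B X *m L.

Definition left_sylvester n m (X : so_system R n)
    (Q : 'M[R]_m) (r : 'cV[R]_m) (Ups : 'M[R]_(m, n)) : Prop :=
  Q ^+ 2 *m Ups *m so_M X + Q *m Ups *m so_D X + Ups *m so_K X
  = r *m so_C0 X + Q *m r *m so_C1 X.

End SecondOrderSystems.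

(* Main.v *)
(* Put P = Ups Pi and let w be a left eigenvector of Qz for the eigenvalue s.
   The Sylvester equation for Ups gives w Ups (s^2 M + s D + K) = (w Rz) C(s),
   where C(s) = C1 s + C0; as s is not in Omega, w Ups B = (w Rz) W(s) = 0.  The
   equation for Pi and the constraints on F1, F2, G, H1 then show that the
   nonzero row [w P, w Rz] annihilates the system matrix of the reduced model
   at s. *)
Require Import Defs.
From HB Require Import structures.
From mathcomp Require Import all_boot all_order all_algebra.
From mathcomp Require Import reals.
From mathcomp Require Import complex.

Set Implicit Arguments.
Unset Strict Implicit.
Unset Printing Implicit Defensive.

Import Order.TTheory GRing.Theory Num.Theory.
Local Open Scope ring_scope.

Lemma map_so_pencil (R : realType) (A A' : nzRingType) (f : R -> A)
    (g : {rmorphism A -> A'}) n (X : so_system R n) (s : A) :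
  map_mx g (so_pencil f X s) = so_pencil (g \o f) X (g s).
Proof. by rewrite /so_pencil !map_mxD !map_mxZ -!map_mx_comp rmorphXn. Qed.

Lemma map_so_output (R : realType) (A A' : nzRingType) (f : R -> A)
    (g : {rmorphism A -> A'}) n (X : so_system R n) (s : A) :
  map_mx g (so_output f X s) = so_output (g \o f) X (g s).
Proof. by rewrite /so_output map_mxD map_mxZ -!map_mx_comp. Qed.

(** The numerator of W over the denominator [so_charpoly]. With the adjugate in place of the inverse
    it makes sense in C[s], C(s) and C alike. *)
Definition so_numer (R : realType) (A : comNzRingType) (f : R -> A) n
    (X : so_system R n) (s : A) : A :=
  (so_output f X s *m \adj (so_pencil f X s) *m map_mx f (so_B X)) 0 0.

(** The adjugate is polynomial in the entries, so it commutes with ring morphisms. The two instances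
    used are evaluation C[s] -> C and the embedding of C[s] in C(s). *)
Lemma rmorph_so_numer (R : realType) (A A' : comNzRingType) (f : R -> A)
    (g : {rmorphism A -> A'}) n (X : so_system R n) (s : A) :
  g (so_numer f X s) = so_numer (g \o f) X (g s).
Proof.
by rewrite /so_numer -map_so_pencil -map_so_output (map_mx_comp f g) -map_mx_adj
  -!map_mxM [RHS]mxE.
Qed.

Lemma horner_eval_real_polyC (R : realType) (s : R[i]) :
  horner_eval s \o @real_polyC R =1 real_complex R.
Proof. by move=> x; rewrite /= /horner_eval hornerC. Qed.

Lemma eq_so_pencil (R : realType) (A : nzRingType) (f g : R -> A) n
    (X : so_system R n) (s : A) :
  f =1 g -> so_pencil f X s = so_pencil g X s.
Proof. by move=> fg; rewrite /so_pencil !(eq_map_mx _ fg). Qed.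

Lemma eq_so_numer (R : realType) (A : comNzRingType) (f g : R -> A) n
    (X : so_system R n) (s : A) :
  f =1 g -> so_numer f X s = so_numer g X s.
Proof.
by move=> fg; rewrite /so_numer /so_output (eq_so_pencil _ _ fg)
  !(eq_map_mx _ fg).
Qed.

Lemma horner_so_numer (R : realType) n (X : so_system R n) (s : R[i]) :
  (so_numer (@real_polyC R) X 'X).[s] = so_numer (real_complex R) X s.
Proof.
rewrite -[LHS]/(horner_eval s _) rmorph_so_numer /= {2}/horner_eval hornerX.
exact/eq_so_numer/horner_eval_real_polyC.
Qed.

Lemma so_transferE (R : realType) n (X : so_system R n) :
  so_charpoly X != 0 ->
  so_transfer X =
    tofrac (so_numer (@real_polyC R) X 'X) / tofrac (so_charpoly X).
Proof.
move=> X0.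
have pencilE : so_pencil (@real_fracC R) X (tofrac 'X) =
    map_mx (@tofrac _) (so_pencil (@real_polyC R) X 'X).
  by rewrite map_so_pencil.
have detE : \det (so_pencil (@real_fracC R) X (tofrac 'X)) =
    tofrac (so_charpoly X).
  by rewrite pencilE det_map_mx.
have det0 : tofrac (so_charpoly X) != 0 by rewrite tofrac_eq0.
rewrite rmorph_so_numer /so_transfer /invmx unitmxE unitfE detE det0.
by rewrite -scalemxAr -scalemxAl mxE mulrC.
Qed.

(** Writing W = p / q and clearing denominators gives numerator * q = p * [so_charpoly X] in C[s].
    At s the right side vanishes, since p(s) = 0 when k > 0, while q(s) is nonzero. *)
Lemma so_numer_eq0 (R : realType) n (X : so_system R n) (s : R[i]) k :
  so_charpoly X != 0 -> (0 < k)%N ->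
  vanishes_to_order (so_transfer X) s k -> so_numer (real_complex R) X s = 0.
Proof.
move=> X0 k0 [p [q [eW qs dvd_p]]].
have q0 : q != 0 by apply: contraNneq qs => ->; rewrite horner0.
have ps : p.[s] = 0.
  by apply/rootP; rewrite -dvdp_XsubCl (dvdp_trans _ dvd_p) // dvdp_exp.
move/eqP: eW; rewrite so_transferE // eqr_div ?tofrac_eq0 // -!rmorphM.
rewrite tofrac_eq => /eqP/(congr1 (horner_eval s)).
rewrite /horner_eval !hornerM ps mul0r horner_so_numer => /eqP.
by rewrite mulf_eq0 (negbTE qs) orbF => /eqP.
Qed.

(** Multiplying the Sylvester equation on the left by w turns every [Q] into the scalar s. The
    defect [E] is zero for the full system and Ups B L for the reduced one. *)
Lemma mulmx_so_pencil (R : realType) n m (X : so_system R n) (Q : 'M[R]_m)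
    (r : 'cV[R]_m) (U E : 'M[R]_(m, n)) (s : R[i]) (w : 'rV[R[i]]_m) :
  Q ^+ 2 *m U *m so_M X + Q *m U *m so_D X + U *m so_K X
    = r *m so_C0 X + Q *m r *m so_C1 X + E ->
  w *m map_mx (real_complex R) Q = s *: w ->
  w *m map_mx (real_complex R) U *m so_pencil (real_complex R) X s
    = w *m map_mx (real_complex R) r *m so_output (real_complex R) X s
      + w *m map_mx (real_complex R) E.
Proof.
move=> /(congr1 (fun V => w *m map_mx (real_complex R) V)) + eQ.
rewrite expr2 !map_mxD !map_mxM 4!mulmxDr !mulmxA !eQ.
rewrite -!scalemxAl eQ -!scalemxAl scalerA -expr2 => eUw.
rewrite /so_pencil /so_output !mulmxDr -!scalemxAr eUw.
by rewrite [X in X + _ = _]addrC.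
Qed.

(** The reduced model inherits the left Sylvester equation multiplied by Pi on the right. The
    constraints on [F1] and [F2] flip its sign, whence [- r], and the equation for Pi produces the
    defect Ups B L. *)
Lemma family_G_sylvester (R : realType) n nu m (X : so_system R n)
    (S : 'M[R]_nu) (L : 'rV[R]_nu) (Pi : 'M[R]_(n, nu))
    (Q : 'M[R]_m) (r : 'cV[R]_m) (Ups : 'M[R]_(m, n))
    (F1 F2 : 'M[R]_nu) (G : 'cV[R]_nu) :
  let Y := family_G X S L Pi F1 F2 G (so_C1 X *m Pi) in
  right_sylvester X S L Pi -> left_sylvester X Q r Ups ->
  Ups *m Pi *m F2 = - (Ups *m so_M X *m Pi) ->
  Ups *m Pi *m F1 = - (Ups *m so_D X *m Pi) ->
  Ups *m Pi *m G = 0 ->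
  Q ^+ 2 *m (Ups *m Pi) *m so_M Y + Q *m (Ups *m Pi) *m so_D Y
      + Ups *m Pi *m so_K Y
    = (- r) *m so_C0 Y + Q *m (- r) *m so_C1 Y + Ups *m so_B X *m L.
Proof.
(* The choice H1 = C1 Pi cancels the terms in S, leaving [so_C0 Y] = C0 Pi. *)
move=> Y ePi eUps eF2 eF1 eG; rewrite /Y /= addrK.
have -> : Ups *m Pi *m (G *m L - F2 *m S ^+ 2 - F1 *m S)
    = Ups *m so_B X *m L - Ups *m so_K X *m Pi.
  rewrite !mulmxBr !mulmxA eG mul0mx eF2 eF1 !mulNmx sub0r !opprK.
  by rewrite -!mulmxA -ePi !mulmxDr !mulmxA addrK.
rewrite -!(mulmxA _ (Ups *m Pi)) eF2 eF1 !(mulmxN, mulNmx) !mulmxA.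
rewrite addrCA addrC; congr (_ + _).
by rewrite -!opprD -!mulmxDl eUps mulmxDl.
Qed.

Theorem theorem4 (R : realType) (n nu m : nat)
  (nu_lt_n : (nu < n)%N) (m_lt_nu : (m < nu)%N)
  (Sigma : so_system R n)
  (Omega_2n : has_roots (so_charpoly Sigma) (2 * n))
  (S : 'M[R]_nu) (L : 'rV[R]_nu)
  (obsLS : observable L S)
  (S_Omega : disjoint_sets (spectrum S) (so_Omega Sigma))
  (Pi : 'M[R]_(n, nu))
  (Pi_sol : unique (right_sylvester Sigma S L) Pi)
  (z : m.-tuple R[i])
  (z_conj : forall s, s \in z -> conjc s \in z)
  (Qz : 'M[R]_m) (Rz : 'cV[R]_m)
  (spec_Qz : has_spectrum Qz z)
  (Qz_Omega : disjoint_sets (spectrum Qz) (so_Omega Sigma))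
  (Qz_S : disjoint_sets (spectrum Qz) (spectrum S))
  (ctrQR : controllable Qz Rz)
  (Ups : 'M[R]_(m, n))
  (Ups_sol : unique (left_sylvester Sigma Qz Rz) Ups)
  (rank_Ups : \rank Ups = m)
  (rank_UpsPi : \rank (Ups *m Pi) = m)
  (z_zeros : zeros_of (so_transfer Sigma) z)
  (F1 F2 : 'M[R]_nu) (G : 'cV[R]_nu) (H1 : 'rV[R]_nu)
  (roots_family :
     has_roots (so_charpoly (family_G Sigma S L Pi F1 F2 G H1)) (2 * nu))
  (eH1 : H1 = so_C1 Sigma *m Pi)
  (eF2 : Ups *m Pi *m F2 = - (Ups *m so_M Sigma *m Pi))
  (eF1 : Ups *m Pi *m F1 = - (Ups *m so_D Sigma *m Pi))
  (eG : Ups *m Pi *m G = 0) :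
  forall s, s \in z -> so_zero (family_G Sigma S L Pi F1 F2 G H1) s.
Proof.
move=> s sz; set cR := real_complex R; case: Omega_2n => X0 _.
have sQ : spectrum Qz s.
  by rewrite /spectrum eigenvalue_root_char spec_Qz root_prod_XsubC.
have Ds : \det (so_pencil cR Sigma s) != 0.
  by have := Qz_Omega s; rewrite sQ.
have /eigenvalueP[w eQ w0] := sQ.
have num0 : so_output cR Sigma s *m \adj (so_pencil cR Sigma s)
    *m map_mx cR (so_B Sigma) = 0.
  rewrite [LHS]mx11_scalar -/(so_numer cR Sigma s).
  (* Here k is the multiplicity of s in [z], positive because s occurs there. *)
  rewrite (so_numer_eq0 X0 _ (z_zeros s sz)) ?raddf0 //.
  by rewrite -has_count has_pred1.
have wB0 : w *m map_mx cR Ups *m map_mx cR (so_B Sigma) = 0.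
  have eU := proj1 Ups_sol; rewrite /left_sylvester -[RHS]addr0 in eU.
  have := mulmx_so_pencil eU eQ; rewrite map_mx0 mulmx0 addr0.
  (* Multiplying by the adjugate and B yields det * (w Ups B) = (w Rz) * numerator = 0, and the
     determinant is nonzero off Omega. *)
  move/(congr1 (fun v => v *m \adj (so_pencil cR Sigma s)
    *m map_mx cR (so_B Sigma))).
  rewrite -(mulmxA _ _ (\adj _)) mul_mx_adj mul_mx_scalar -scalemxAl.
  rewrite -!mulmxA (mulmxA (so_output _ _ _)) num0 !mulmx0 !mulmxA => /eqP.
  by rewrite scaler_eq0 (negbTE Ds) => /eqP.
subst H1; set Y := family_G _ _ _ _ _ _ _ _.
have := mulmx_so_pencil
  (family_G_sylvester (proj1 Pi_sol) (proj1 Ups_sol) eF2 eF1 eG) eQ.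
rewrite -/Y map_mxN mulmxN mulNmx !map_mxM /= !mulmxA wB0 mul0mx addr0 => eP.
apply/eqP/det0P.
exists (row_mx (w *m map_mx cR (Ups *m Pi)) (w *m map_mx cR Rz)).
  (* The left block alone is nonzero: Ups Pi has full row rank, so w Ups Pi = 0 would force w =
     0. *)
  apply: contraNneq w0 => /(congr1 lsubmx).
  rewrite row_mxKl linear0 => /eqP; rewrite mulmx_free_eq0 //.
  by rewrite /row_free mxrank_map rank_UpsPi.
rewrite mul_row_block mulmx0 addr0 map_mxM !mulmxA eP addNr mulmxN.
by rewrite -2!mulmxA -!map_mxM eG map_mx0 mulmx0 oppr0 row_mx0.
Qed.
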